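(* Let $n\ge 1$, let $E \subset \mathbb{R}^n$ be a non-empty bounded set and let $\theta \in (0, 1]$. Then $$\underline{\dim}_{\,\theta} E = \underline{\dim}_{\,\theta}^{\,n} E \qquad\text{and}\qquad \overline{\dim}_{\,\theta} E = \overline{\dim}_{\,\theta}^{\,n} E,$$ where the left-hand sides are the lower and upper intermediate dimensions of $E$ (defined by covers) and the right-hand sides are the lower and upper intermediate dimension profiles of $E$ with $m=n$ (defined by capacities).
   Context: Intermediate dimensions. $|U|$ denotes the diameter of a set $U\subset\mathbb{R}^n$; covers are countable (finite or infinite). For $E\subset\mathbb{R}^n$ and $0<\theta\le 1$, the lower intermediate dimension $\underline{\dim}_{\,\theta}E$ is the infimum of all $s\ge 0$ such that for all $\epsilon>0$ and all $r_0>0$ there exist $0<r\le r_0$ and a cover $\{U_i\}$ of $E$ with $r^{1/\theta}\le |U_i|\le r$ for all $i$ and $\sum_i |U_i|^s\le\epsilon$. The upper intermediate dimension $\overline{\dim}_{\,\theta}E$ is the infimum of all $s\ge 0$ such that for all $\epsilon>0$ there exists $r_0>0$ such that for all $0<r\le r_0$ there is a cover $\{U_i\}$ of $E$ with $r^{1/\theta}\le |U_i|\le r$ for all $i$ and $\sum_i |U_i|^s\le\epsilon$. Kernels and capacities. For $\theta\in(0,1]$, $m\in\{1,\dots,n\}$, $0\le s\le m$ and $0<r<1$, define for $x\in\mathbb{R}^n$ $$\phi_{r,\theta}^{s,m}(x)=\begin{cases}1 & 0\le|x|<r\\ (r/|x|)^s & r\le|x|<r^\theta\\ r^{\theta(m-s)+s}/|x|^m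 & r^\theta\le|x|.\end{cases}$$ For compact non-empty $E$ let $\mathcal{M}(E)$ be the set of Borel probability measures supported on $E$. The capacity of $E$ is $$C_{r,\theta}^{s,m}(E)=\Big(\inf_{\mu\in\mathcal{M}(E)}\int\!\!\int\phi_{r,\theta}^{s,m}(x-y)\,d\mu(x)\,d\mu(y)\Big)^{-1}.$$ For bounded, not necessarily closed, $E$ the capacity is defined to be that of the closure of $E$. Dimension profiles. For $m\in\{1,\dots,n\}$, the lower intermediate dimension profile $\underline{\dim}_{\,\theta}^{\,m}E$ is the unique $s\in[0,m]$ such that $\liminf_{r\to0}\frac{\log C_{r,\theta}^{s,m}(E)}{-\log r}=s$, and the upper intermediate dimension profile $\overline{\dim}_{\,\theta}^{\,m}E$ is the unique $s\in[0,m]$ such that $\limsup_{r\to0}\frac{\log C_{r,\theta}^{s,m}(E)}{-\log r}=s$ (such unique values exist). *)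

(* Defs.v *)
From HB Require Import structures.
From mathcomp Require Import all_boot all_order all_algebra.
From mathcomp Require Import all_classical all_reals all_analysis.

Set Implicit Arguments.
Unset Strict Implicit.
Unset Printing Implicit Defensive.

Import Order.TTheory GRing.Theory Num.Theory.
Import numFieldNormedType.Exports.

Local Open Scope classical_set_scope.
Local Open Scope ring_scope.

(** The library norm on ['rV[R]_n] is the sup norm; metric notions below use the
    Euclidean norm. The topology (hence [closure], [bounded_set] and the Borel
    sets) is the same for both norms. *)
Definition enorm (R : realType) (n : nat) (x : 'rV[R]_n) : R :=
  Num.sqrt (\sum_(i < n) x ord0 i ^+ 2).

(** Extended-real valued, so that unbounded sets have diameter [+oo]; the maximum
    with [0] only matters for the empty set, whose supremum would be [-oo]. *)
Definition diam (R : realType) (n : nat) (U : set 'rV[R]_n) : \bar R :=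
  maxe 0%E (ereal_sup [set (enorm (p.1 - p.2))%:E | p in U `*` U]).

(** Countable (finite or infinite) covers are families indexed by a subset [D]
    of [nat]. *)
Definition has_cover (R : realType) (n : nat) (theta : R) (E : set 'rV[R]_n)
    (s eps r : R) : Prop :=
  exists (D : set nat) (U : nat -> set 'rV[R]_n),
    [/\ E `<=` \bigcup_(i in D) U i,
        forall i, D i ->
          ((r `^ theta^-1)%:E <= diam (U i))%E /\ (diam (U i) <= r%:E)%E
      & (\esum_(i in D) (poweR (diam (U i)) s) <= eps%:E)%E].

Definition lower_intermediate_dim (R : realType) (n : nat) (theta : R)
    (E : set 'rV[R]_n) : \bar R :=
  ereal_inf [set s%:E | s in [set s : R | 0 <= s /\
    forall eps r0 : R, 0 < eps -> 0 < r0 ->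
      exists r : R, [/\ 0 < r, r <= r0 & has_cover theta E s eps r]]].

Definition upper_intermediate_dim (R : realType) (n : nat) (theta : R)
    (E : set 'rV[R]_n) : \bar R :=
  ereal_inf [set s%:E | s in [set s : R | 0 <= s /\
    forall eps : R, 0 < eps ->
      exists r0 : R, 0 < r0 /\
        forall r : R, 0 < r -> r <= r0 -> has_cover theta E s eps r]].

Definition kernel_phi (R : realType) (n : nat) (r theta s : R) (m : nat)
    (x : 'rV[R]_n) : R :=
  if enorm x < r then 1
  else if enorm x < r `^ theta then (r / enorm x) `^ s
  else r `^ (theta * (m%:R - s) + s) / enorm x ^+ m.

(** [R^n] with its Borel sigma-algebra. *)
Definition borel_rV (R : realType) (n : nat) :=
  g_sigma_algebraType (@open 'rV[R]_n).

Definition probability_on (R : realType) (n : nat) (E : set 'rV[R]_n) :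
    set (probability (borel_rV R n) R) :=
  [set mu | mu (~` E) = 0%E].

Definition energy (R : realType) (n : nat) (r theta s : R) (m : nat)
    (mu : probability (borel_rV R n) R) : \bar R :=
  (\int[mu]_y \int[mu]_x
     (kernel_phi r theta s m ((x : 'rV[R]_n) - (y : 'rV[R]_n)))%:E)%E.

(** Capacity of a compact non-empty set. *)
Definition compact_capacity (R : realType) (n : nat) (r theta s : R) (m : nat)
    (E : set 'rV[R]_n) : \bar R :=
  ((ereal_inf [set energy r theta s m mu | mu in probability_on E])^-1)%E.

(** Capacity of a bounded non-empty set. *)
Definition capacity (R : realType) (n : nat) (r theta s : R) (m : nat)
    (E : set 'rV[R]_n) : \bar R :=
  compact_capacity r theta s m (closure E).

Definition log_capacity_ratio (R : realType) (n : nat) (theta s : R) (m : nat)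
    (E : set 'rV[R]_n) (r : R) : \bar R :=
  (lne (capacity r theta s m E) / (- ln r)%:E)%E.

Definition is_lower_profile (R : realType) (n : nat) (m : nat) (theta : R)
    (E : set 'rV[R]_n) (s : R) : Prop :=
  [/\ 0 <= s, s <= m%:R &
      limf_einf (log_capacity_ratio theta s m E) 0^'+ = s%:E].

Definition is_upper_profile (R : realType) (n : nat) (m : nat) (theta : R)
    (E : set 'rV[R]_n) (s : R) : Prop :=
  [/\ 0 <= s, s <= m%:R &
      limf_esup (log_capacity_ratio theta s m E) 0^'+ = s%:E].

(** Definite descriptions. The default [-1] lies outside [[0, m]], so a
    non-negative value is necessarily the unique [s] in [[0, m]] as required. *)
Definition lower_profile (R : realType) (n : nat) (m : nat) (theta : R)
    (E : set 'rV[R]_n) : R :=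
  xget (-1) [set s | unique (is_lower_profile m theta E) s].

Definition upper_profile (R : realType) (n : nat) (m : nat) (theta : R)
    (E : set 'rV[R]_n) : R :=
  xget (-1) [set s | unique (is_upper_profile m theta E) s].

(* Main.v *)
(* Write [rho = r^theta] and let [gamma] be the infimum of the energies, so that the
   capacity is [gamma^-1]; covers use sets of diameter in [[r, rho]].

   If [U_i] is a cover, then on pairs of points of [closure U_i] the kernel is at
   least [(r / |U_i|)^s], and Cauchy-Schwarz gives
   [gamma >= r^s / \sum_i |U_i|^s].

   Conversely, a finitely supported near-minimiser of the energy has potential at
   least [gamma / 2] at every point of [E]. Splitting the kernel into [K + 1]
   scales between [r] and [r^-1], each point of [E] receives a [1 / (K + 1)] share
   of this from one scale. Counting the grid cubes that meet the points attached to
   each scale yields a cover with [\sum_i |U_i|^s <= C_K r^(s - 2 n / K) / gamma].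

   Hence [log C / -log r] is, up to [o(1)], [s] plus the exponent of growth of the
   optimal cover sum. The latter is strictly decreasing in [s] because
   [r <= |U_i| <= r^theta], and its unique zero is the intermediate dimension. *)

Require Import Defs.
From HB Require Import structures.
From mathcomp Require Import all_boot all_order all_algebra finmap.
From mathcomp Require Import all_classical all_reals all_analysis.
From mathcomp Require Import measurable_realfun lra ring.

Set Implicit Arguments.
Unset Strict Implicit.
Unset Printing Implicit Defensive.

Import Order.TTheory GRing.Theory Num.Theory.
Import numFieldNormedType.Exports.

Local Open Scope classical_set_scope.
Local Open Scope ring_scope.

(** * Integral inequalities *)

Section integral_bounds.
Local Open Scope ereal_scope.
Context d (T : measurableType d) (R : realType).

Import HBNNSimple.

(* Thanks to this lemma and to [discrete_probability], the measurability of the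
   kernel is never needed. *)
Lemma ge0_le_integral_nonmeasurable (mu : {measure set T -> \bar R})
    (f g : T -> \bar R) :
  (forall x, 0 <= f x) -> (forall x, f x <= g x) ->
  \int[mu]_x f x <= \int[mu]_x g x.
Proof.
move=> f0 fg; rewrite !ge0_integralTE//; last by move=> x; exact: le_trans (fg x).
apply: ereal_sup_le => _ [h /= hf <-]; exists h => // x.
exact: le_trans (fg x).
Qed.

(* Cauchy-Schwarz in tangent form: [c m^2 >= 2 l m - l^2 / c], summed over a
   partition subordinate to [W], at [l = (\sum_i 1 / c i)^-1]. *)
Lemma energy_ge_inv_sum (mu : probability T R) (k : T -> T -> \bar R) (N : nat)
    (W : nat -> set T) (c : nat -> R) :
  (forall x y, 0 <= k x y) -> (forall i, measurable (W i)) ->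
  (forall i, (0 < c i)%R) ->
  (forall i x y, (i < N)%N -> W i x -> W i y -> (c i)%:E <= k x y) ->
  mu (\big[setU/set0]_(i < N) W i) = 1 ->
  ((\sum_(i < N) (c i)^-1)^-1)%:E <= \int[mu]_y \int[mu]_x k x y.
Proof.
move=> k0 mW c0 kc muW.
pose V := seqDU W.
have mV i : measurable (V i) by exact: seqDU_measurable.
pose m i := fine (mu (V i)).
have mE i : mu (V i) = (m i)%:E by rewrite fineK// fin_num_measure.
have m0 i : (0 <= m i)%R by rewrite fine_ge0.
have tV : trivIset setT V by exact: trivIset_seqDU.
have sm1 : (\sum_(i < N) m i)%R = 1%R.
  apply: EFin_inj; rewrite -sumEFin -muW bigsetU_seqDU.
  rewrite measure_bigsetU//.
  by apply: eq_bigr => i _; rewrite -mE.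
(* For [y] in [V i], restrict the inner integral to [V i], where the kernel is at least [c i].
   Integrating in [y] then leaves [\sum_i c i * m i ^+ 2]. *)
have inner y : (\sum_(i < N) (c i * m i) * \1_(V i) y)%R%:E <= \int[mu]_x k x y.
  have [[i [iN Viy]]|nV] := pselect (exists i, (i < N)%N /\ V i y); last first.
    rewrite big1 ?integral_ge0// => i _.
    rewrite indicE memNset ?mulr0// => Viy.
    by apply: nV; exists i; split.
  rewrite (bigD1 (Ordinal iN))//= indicE mem_set// mulr1 big1 ?addr0; last first.
    move=> j /eqP ji; rewrite indicE memNset ?mulr0// => Vjy.
    apply: ji; apply/val_inj => /=; apply: (tV _ _ Logic.I Logic.I).
    by exists y.
  have -> : (c i * m i)%:E = \int[mu]_x (c i * \1_(V i) x)%:E.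
    rewrite (@integralZl_indic _ _ _ _ _ _ (fun=> V i))//; last first.
      by move=> ci; move: (c0 i); rewrite ltNge (ltW ci).
    by rewrite integral_indic// setIT EFinM -mE.
  apply: ge0_le_integral_nonmeasurable => x; first by rewrite lee_fin mulr_ge0// ltW.
  have [Vix|Vix] := pselect (V i x).
    rewrite indicE mem_set// mulr1; apply: kc => //; exact: subset_seqDU.
  by rewrite indicE memNset// mulr0.
have cm0 i : (0 <= c i * m i)%R by rewrite mulr_ge0// ltW.
apply: (@le_trans _ _ (\int[mu]_y (\sum_(i < N) (c i * m i) * \1_(V i) y)%R%:E)); last first.
  apply: ge0_le_integral_nonmeasurable => // y.
  by rewrite lee_fin sumr_ge0// => i _; rewrite mulr_ge0.
under eq_integral do rewrite -sumEFin.
rewrite ge0_integral_sum//; last 2 first.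
- move=> i; apply/measurable_EFinP; apply: measurable_funM => //.
- by move=> i y _; rewrite lee_fin mulr_ge0.
have -> : \sum_(i < N) \int[mu]_y (c i * m i * \1_(V i) y)%:E =
   (\sum_(i < N) c i * m i ^+ 2)%R%:E.
  rewrite -[RHS]sumEFin.
  apply: eq_bigr => i _.
  have cmN : (c i * m i < 0)%R -> V i = set0 by rewrite ltNge cm0.
  rewrite (@integralZl_indic _ _ _ _ _ _ (fun=> V i))//.
  by rewrite integral_indic// setIT expr2 mulrA !EFinM -mE.
rewrite lee_fin.
set S := (\sum_(i < N) _^-1)%R.
have S0 : (0 < S)%R.
  case: N @S {kc muW inner} sm1 => [|N] S.
    by rewrite big_ord0 => /eqP; rewrite eq_sym oner_eq0.
  move=> _; rewrite /S big_ord_recl ltr_pwDl ?invr_gt0// sumr_ge0// => i _.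
  by rewrite invr_ge0 ltW.
have -> : (S^-1 = \sum_(i < N) (2 * S^-1 * m i - S^-1 ^+ 2 * (c i)^-1))%R.
  rewrite big_split/= sumrN -!mulr_sumr -/S sm1 mulr1.
  by field; rewrite gt_eqF.
apply: ler_sum => i _.
rewrite -subr_ge0.
have -> : (c i * m i ^+ 2 - (2 * S^-1 * m i - S^-1 ^+ 2 / c i) =
   c i * (m i - S^-1 / c i) ^+ 2)%R.
  by field; rewrite !gt_eqF.
by rewrite mulr_ge0 ?sqr_ge0// ltW.
Qed.

(** The integral of [f] is a supremum over simple functions below [f], and each of these integrates
    exactly to its weighted sum over the atoms. This yields one inequality for arbitrary nonnegative
    [f], the direction that bounds minimal energies from above. *)
Lemma discrete_probability (s : seq (R * T)) (A : set T) :
  (forall q, q \in s -> (0 <= q.1)%R) -> (\sum_(q <- s) q.1 = 1)%R ->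
  measurable A -> (forall q, q \in s -> A q.2) ->
  exists mu : probability T R, mu (~` A) = 0 /\
    forall f : T -> \bar R, (forall x, 0 <= f x) ->
      \int[mu]_x f x <= \sum_(q <- s) q.1%:E * f q.2.
Proof.
move=> s0 s1 mA sA.
have [[w0 x0] s_x0] : exists q, q \in s.
  case: s s1 {s0 sA} => [|q s _]; last by exists q; rewrite mem_head.
  by rewrite big_nil => /eqP; rewrite eq_sym oner_eq0.
pose q i := nth (w0, x0) s i.
pose m i : {measure set T -> \bar R} := mscale (NngNum (normr_ge0 (q i).1)) \d_(q i).2.
pose nu : {measure set T -> \bar R} := msum m (size s).
have mE i B : (i < size s)%N -> m i B = (q i).1%:E * \d_(q i).2 B.
  by move=> si; congr (_%:E * _); rewrite /= ger0_norm// s0// mem_nth.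
have nuT : nu setT = 1.
  rewrite /nu/= /msum; under eq_bigr do rewrite mE// diracT mule1.
  by rewrite sumEFin -s1 (big_nth (w0, x0)) big_mkord.
(* The mass of [nu] is already 1, so normalising only packages [nu] as a probability. *)
pose mu : probability T R := mnormalize nu \d_x0.
have muE B : mu B = nu B.
  have -> : mu B = mnormalize nu \d_x0 B by [].
  by rewrite /mnormalize nuT onee_eq0/= invr1 mule1.
exists mu; split.
  rewrite muE /nu/= /msum big1// => i _.
  by rewrite mE// diracE memNset ?mule0//= => /(_ (sA _ (mem_nth _ (ltn_ord i)))).
move=> f f0; rewrite ge0_integralTE//; apply: ge_ereal_sup => _ [h /= hf <-].
rewrite -[X in X <= _](_ : \int[mu]_x (h x)%:E = _); last first.
  by rewrite integral_nnsfun// patch_setT.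
rewrite (eq_measure_integral nu); last by move=> B _ _; exact: muE.
have h0 x : 0 <= (h x)%:E by rewrite lee_fin.
have mh : measurable_fun setT (EFin \o h) by exact/measurable_EFinP.
rewrite ge0_integral_measure_sum//.
rewrite (big_nth (w0, x0)) big_mkord.
apply: lee_sum => i _; rewrite ge0_integral_mscale//.
rewrite integral_dirac// diracT mul1e /= -/(q i).
have qi0 : (0 <= (q i).1)%R by apply: s0; exact: mem_nth.
by rewrite ger0_norm//; apply: lee_wpmul2l; rewrite ?lee_fin//.
Qed.

End integral_bounds.

(** * Euclidean norm and diameter *)

Section euclidean.
Context (R : realType) (n : nat).
Implicit Types (x y : 'rV[R]_n) (U E : set 'rV[R]_n).

Lemma enorm_ge0 x : 0 <= enorm x.
Proof. exact: sqrtr_ge0. Qed.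

Lemma enorm0 : enorm (0 : 'rV[R]_n) = 0.
Proof.
by rewrite /enorm big1 ?sqrtr0// => i _; rewrite mxE expr0n.
Qed.

Lemma enorm_distC x y : enorm (x - y) = enorm (y - x).
Proof.
by congr Num.sqrt; apply: eq_bigr => i _; rewrite -opprB mxE sqrrN.
Qed.

Lemma normr_coord_le_enorm x i : `|x ord0 i| <= enorm x.
Proof.
rewrite -sqrtr_sqr ler_sqrt; last by apply: sumr_ge0 => j _; exact: sqr_ge0.
by rewrite (bigD1 i)//= lerDl; apply: sumr_ge0 => j _; exact: sqr_ge0.
Qed.

Lemma enorm_le_box x (h : R) :
  (forall i, `|x ord0 i| <= h) -> 0 <= h -> enorm x <= Num.sqrt n%:R * h.
Proof.
move=> xh h0; rewrite -[h in leRHS]ger0_norm// -sqrtr_sqr -sqrtrM//.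
rewrite ler_sqrt ?mulr_ge0 ?sqr_ge0//.
have -> : n%:R * h ^+ 2 = \sum_(i < n) h ^+ 2.
  by rewrite sumr_const card_ord mulr_natl.
apply: ler_sum => i _; rewrite -real_normK ?num_real//.
by rewrite ler_pXn2r ?nnegrE.
Qed.

Lemma enorm_const (h : R) : 0 <= h ->
  enorm (const_mx h : 'rV[R]_n) = Num.sqrt n%:R * h.
Proof.
move=> h0; rewrite /enorm; under eq_bigr do rewrite mxE.
by rewrite sumr_const card_ord -[_ *+ n]mulr_natl sqrtrM// sqrtr_sqr ger0_norm.
Qed.

Lemma continuous_enorm_sub y : continuous (fun x => enorm (x - y)).
Proof.
move=> x; apply: (@continuous_comp _ _ _
  (fun z : 'rV[R]_n => \sum_(i < n) (z - y) ord0 i ^+ 2) Num.sqrt).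
  have sqr_cont i : continuous (fun z : 'rV[R]_n => (z - y) ord0 i ^+ 2).
    rewrite (_ : (fun z => _) = (fun z : 'rV[R]_n => (z ord0 i - y ord0 i) ^+ 2)); last first.
      by apply/funext => z; rewrite !mxE.
    move=> z; apply: (@continuous_comp _ _ _ (fun z : 'rV[R]_n => z ord0 i - y ord0 i)
      (fun t : R => t ^+ 2)); last exact: exprn_continuous.
    apply: (@continuousB _ R^o); last exact: cst_continuous.
    exact: (@coord_continuous R _ _ ord0 i).
  apply: (@continuous_big _ _ +%R 0 xpredT _ _ _
    (fun i (z : 'rV[R]_n) => (z - y) ord0 i ^+ 2)) => //.
  exact: add_continuous.
exact: sqrt_continuous.
Qed.

(** The condition is closed in each variable, so it extends to the closure one variable at a time.
    Capacities live on [closure E], whereas covers and diameter bounds concern [E]. *)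
Lemma enorm_sub_le_closure U (d : R) :
  (forall x y, U x -> U y -> enorm (x - y) <= d) ->
  forall x y, closure U x -> closure U y -> enorm (x - y) <= d.
Proof.
move=> Ud.
have cl y : closed [set x | enorm (x - y) <= d].
  apply: (@preimage_closed _ _ (fun x => enorm (x - y)) [set t | t <= d]).
    by move=> x _; exact: continuous_enorm_sub.
  exact: closed_le.
have Ucl x y : closure U x -> U y -> enorm (x - y) <= d.
  move=> Ux Uy.
  by apply: (cl y); apply: closureS Ux => z Uz; exact: Ud.
move=> x y Ux Uy; rewrite enorm_distC.
apply: (cl x); apply: closureS Uy => z Uz /=.
by rewrite enorm_distC; exact: Ucl.
Qed.

(** The factor [sqrt n] passes from the sup norm of [bounded_set] to the Euclidean norm. The bound
    is kept at least 1 for use in [kernel_ge_pow]. *)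
Lemma bounded_enorm_sub E : bounded_set E ->
  exists2 d : R, 1 <= d & forall x y, E x -> E y -> enorm (x - y) <= d.
Proof.
move=> [M0 [_ hM0]]; pose M := M0 + 1.
have hM : forall x, E x -> `|x| <= M by apply: hM0; rewrite ltrDl.
have M_ge0 x : E x -> 0 <= M by move=> Ex; exact: le_trans (hM _ Ex).
have {}hM x : E x -> forall i, `|x ord0 i| <= M.
  move=> Ex i; apply: le_trans (hM _ Ex).
  by rewrite [leRHS]/Num.norm /= mx_normrE (le_bigmax _ (fun ij => `|x ij.1 ij.2|) (ord0, i)).
exists (Num.max 1 (Num.sqrt n%:R * (M + M))); first by rewrite le_max lexx.
move=> x y Ex Ey; rewrite le_max; apply/orP; right.
apply: enorm_le_box => [i|].
  rewrite !mxE (le_trans (ler_normB _ _))// lerD//; exact: hM.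
by rewrite addr_ge0// (M_ge0 _ Ex).
Qed.

Lemma diam_le U (d : R) : 0 <= d ->
  (diam U <= d%:E)%E <-> (forall x y, U x -> U y -> enorm (x - y) <= d).
Proof.
move=> d0; rewrite /diam ge_max lee_fin d0/=; split.
  move=> Ud x y Ux Uy; rewrite -lee_fin; apply: le_trans Ud.
  by apply: ereal_sup_ubound; exists (x, y).
move=> Ud; apply: ge_ereal_sup => _ [[x y] /= [Ux Uy] <-].
by rewrite lee_fin; exact: Ud.
Qed.

End euclidean.

(** * The kernel *)

Lemma powRD_gt0 (R : realType) (a x y : R) : 0 < a ->
  a `^ (x + y) = a `^ x * a `^ y.
Proof. by move=> a0; rewrite powRD// (gt_eqF a0) implybT. Qed.

Lemma powRB_gt0 (R : realType) (a x y : R) : 0 < a ->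
  a `^ (x - y) = a `^ x / a `^ y.
Proof. by move=> a0; rewrite powRB// (gt_eqF a0) implybT. Qed.

Section kernel.
Context (R : realType) (n m : nat) (r theta s : R).
Hypotheses (r_gt0 : 0 < r) (r_lt1 : r < 1) (theta_le1 : theta <= 1).
Hypotheses (s_ge0 : 0 <= s) (s_le : s <= m%:R).
Implicit Types x : 'rV[R]_n.

Local Notation rho := (r `^ theta).
Local Notation phi := (@kernel_phi R n r theta s m).

Let rho_gt0 : 0 < rho. Proof. exact: powR_gt0. Qed.

Lemma ler_powR_theta : r <= rho.
Proof. by rewrite ger1_powR// r_gt0 ltW. Qed.

Lemma kernel_ge0 x : 0 <= phi x.
Proof.
rewrite /kernel_phi; case: ifP => // _; case: ifP => _; first exact: powR_ge0.
by rewrite divr_ge0 ?powR_ge0// exprn_ge0// enorm_ge0.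
Qed.

Lemma kernel_distC x y : phi (x - y) = phi (y - x).
Proof. by rewrite /kernel_phi enorm_distC. Qed.

Lemma kernel0 : phi 0 = 1.
Proof. by rewrite /kernel_phi enorm0 r_gt0. Qed.

(** The minimum merges the two outer branches of the kernel: below [rho] the powers of [enorm x]
    combine to [enorm x] to the [-s]. *)
Lemma kernelE x : r <= enorm x ->
  phi x = r `^ s * Num.min (enorm x) rho `^ (m%:R - s) / enorm x ^+ m.
Proof.
move=> rx; have x0 : 0 < enorm x by exact: lt_le_trans rx.
rewrite /kernel_phi ltNge rx/=; case: ltP => [xrho|rhox].
  rewrite powRM ?(ltW r_gt0) ?invr_ge0 ?(ltW x0)// powRB_gt0//.
  rewrite powR_mulrn ?(ltW x0)// -[(enorm x)^-1]powR_inv1 ?(ltW x0)// -powRrM mulN1r powRN.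
  by field; rewrite !gt_eqF ?exprn_gt0 ?powR_gt0.
by rewrite powRD_gt0// powRrM [_ * r `^ s]mulrC.
Qed.

(** Up to radius [rho] the kernel is [(r / |x|)^s], decreasing in [|x|]. It is applied to
    differences of points in a covering set of diameter [delta]. *)
Lemma kernel_ge_ball x (delta : R) :
  r <= delta -> delta <= rho -> enorm x <= delta ->
  (r / delta) `^ s <= phi x.
Proof.
move=> rd drho xd; have d0 : 0 < delta by exact: lt_le_trans rd.
have [xr|rx] := ltP (enorm x) r.
  rewrite /kernel_phi xr -[leRHS](powRr0 (r / delta)) ger_powR//.
  by rewrite divr_gt0//= ler_pdivrMr// mul1r.
have x0 : 0 < enorm x by exact: lt_le_trans rx.
rewrite kernelE//.
have -> : Num.min (enorm x) rho = enorm x by apply/min_idPl; exact: le_trans drho.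
rewrite powRB_gt0// powR_mulrn ?(ltW x0)//.
rewrite (_ : _ / enorm x ^+ m = r `^ s / enorm x `^ s); last first.
  by field; rewrite !gt_eqF ?exprn_gt0 ?powR_gt0.
rewrite powRM ?(ltW r_gt0) ?invr_ge0 ?(ltW d0)//.
rewrite -[(delta)^-1]powR_inv1 ?(ltW d0)// -powRrM mulN1r powRN.
by rewrite ler_pM2l ?powR_gt0// lef_pV2 ?posrE ?powR_gt0// ge0_ler_powR// nnegrE ltW.
Qed.

(** In [kernelE] the minimum is at least [r], so the numerator is at least [r ^+ m]. This crude
    bound keeps energies positive and capacities polynomial in [r^-1]. *)
Lemma kernel_ge_pow x (D : R) : 1 <= D -> enorm x <= D ->
  (r / D) ^+ m <= phi x.
Proof.
move=> D1 xD; have D0 : 0 < D by exact: lt_le_trans D1.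
have [xr|rx] := ltP (enorm x) r.
  rewrite /kernel_phi xr exprn_ile1 ?divr_ge0 ?ltW//.
  by rewrite ltr_pdivrMr// mul1r; exact: lt_le_trans D1.
have x0 : 0 < enorm x by exact: lt_le_trans rx.
rewrite kernelE// expr_div_n ler_pM ?invr_ge0 ?exprn_ge0 ?(ltW r_gt0) ?(ltW D0)//.
  rewrite -powR_mulrn ?(ltW r_gt0)// -{1}(subrKC s m%:R) powRD_gt0//.
  rewrite ler_pM2l ?powR_gt0// ge0_ler_powR ?subr_ge0 ?nnegrE ?(ltW r_gt0)//.
    by rewrite le_min (ltW x0) ltW.
  by rewrite le_min rx ler_powR_theta.
by rewrite lef_pV2 ?posrE ?exprn_gt0// lerXn2r ?nnegrE ?(ltW x0) ?(ltW D0).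
Qed.

(** * Geometric scales between [r] and [r^-1] *)

Section scales.
Variable K : nat.
Hypothesis K_gt0 : (0 < K)%N.

(* Radii growing from [r] to [r^-1] by factors [r ^ (-2 / K)], so that replacing
   the kernel by a step function costs only a small power of [r]; the covering
   cells stop growing at [rho], beyond which a ball is cut into several cells. *)
Definition scale (k : nat) : R := r `^ (1 - 2 * k%:R / K%:R).

Definition cell_diam (k : nat) : R := Num.min (scale k) rho.

(** The expression of [kernelE] at distance [scale k], enlarged by the [m]-th power of the ratio of
    consecutive scales, so that it still dominates the kernel at distance [scale (k - 1)]. *)
Definition scale_weight (k : nat) : R :=
  r `^ (- (2 * m%:R / K%:R)) * (r `^ s * cell_diam k `^ (m%:R - s) / scale k ^+ m).

Lemma scale_gt0 k : 0 < scale k. Proof. exact: powR_gt0. Qed.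

Lemma cell_diam_gt0 k : 0 < cell_diam k.
Proof. by rewrite lt_min scale_gt0 rho_gt0. Qed.

Let K0 : 0 < K%:R :> R. Proof. by rewrite ltr0n. Qed.

Lemma scale0 : scale 0 = r.
Proof. by rewrite /scale mulr0 mul0r subr0 powRr1// ltW. Qed.

Lemma scaleS k : scale k.+1 = scale k * r `^ (- (2 / K%:R)).
Proof.
rewrite /scale -powRD_gt0//.
by congr (r `^ _); rewrite -natr1; field; rewrite gt_eqF.
Qed.

Lemma cell_diam_ge k : r <= cell_diam k.
Proof.
by rewrite le_min ler_powR_theta andbT ger1_powR ?r_gt0 ?(ltW r_lt1)// gerBl divr_ge0.
Qed.

Lemma cell_diam_le k : cell_diam k <= rho.
Proof. by rewrite ge_min lexx orbT. Qed.

Lemma scale_weight_ge0 k : 0 <= scale_weight k.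
Proof.
by rewrite mulr_ge0 ?powR_ge0// divr_ge0 ?mulr_ge0 ?powR_ge0// exprn_ge0// ltW// scale_gt0.
Qed.

(** The weight, times the order of the number of cells in a ball of radius [scale k], times the cost
    of one cell, does not depend on [k]: every scale contributes equally to the cover sum. *)
Lemma scale_weightE k :
  scale_weight k * (scale k / cell_diam k) ^+ m * cell_diam k `^ s =
  r `^ (s - 2 * m%:R / K%:R).
Proof.
have b0 := cell_diam_gt0 k; have a0 := scale_gt0 k.
rewrite /scale_weight [in RHS]addrC [RHS]powRD_gt0//.
rewrite powRB_gt0// powR_mulrn ?(ltW b0)// expr_div_n.
field; rewrite !gt_eqF ?exprn_gt0 ?powR_gt0//.
Qed.

(** Take the first scale exceeding [enorm x]; one exists because [scale K] is [r^-1]. Either it is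
    [scale 0 = r], where the kernel is 1, or the previous scale is at most [enorm x]. *)
Lemma kernel_le_scale_weight x : enorm x < r^-1 ->
  exists k, [/\ (k <= K)%N, enorm x < scale k & phi x <= scale_weight k].
Proof.
move=> xr; have K_P : enorm x < scale K.
  rewrite /scale mulfK ?gt_eqF// (_ : 1 - 2 = -1 :> R); last by ring.
  by rewrite powR_inv1// ltW.
have exk : exists k, enorm x < scale k by exists K.
case: (ex_minnP exk) => k xk mink; exists k; split=> //; first exact: mink.
have C1 : 1 <= r `^ (- (2 * m%:R / K%:R)).

  by rewrite -[leLHS](powRr0 r) ger_powR ?r_gt0 ?(ltW r_lt1)// oppr_le0 divr_ge0.
case: k xk mink => [|k] xk mink.
  rewrite scale0 in xk; rewrite /kernel_phi xk.
  rewrite /scale_weight /cell_diam scale0 (min_idPl ler_powR_theta).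
  rewrite -powRD_gt0// subrKC powR_mulrn ?(ltW r_gt0)//.
  by rewrite divff ?mulr1// gt_eqF ?exprn_gt0.
have kx : scale k <= enorm x.
  by rewrite leNgt; apply/negP => /mink; rewrite ltnn.
have rk : r <= scale k.
  by apply: le_trans (cell_diam_ge k) _; rewrite ge_min lexx.
have rx := le_trans rk kx.
have x0 : 0 < enorm x by exact: lt_le_trans rx.
rewrite kernelE// /scale_weight.
have -> : r `^ (- (2 * m%:R / K%:R)) = (scale k.+1 / scale k) ^+ m.
  rewrite scaleS (_ : _ / scale k = r `^ (- (2 / K%:R))); last first.
    by rewrite mulrC mulKf// gt_eqF ?scale_gt0.
  by rewrite -powR_mulrn ?powR_ge0// -powRrM; congr (r `^ _); ring.
rewrite expr_div_n.
have -> (A : R) : scale k.+1 ^+ m / scale k ^+ m * (A / scale k.+1 ^+ m) = A / scale k ^+ m.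
  by field; rewrite !gt_eqF ?exprn_gt0 ?scale_gt0.
rewrite ler_pM ?invr_ge0 ?mulr_ge0 ?exprn_ge0 ?powR_ge0 ?(ltW x0)//.
  rewrite ler_pM2l ?powR_gt0// ge0_ler_powR ?subr_ge0 ?nnegrE//.
  - by rewrite le_min !ltW.
  - by rewrite ltW// cell_diam_gt0.
  - by rewrite le_min !ge_min (ltW xk) lexx !orbT.
rewrite lef_pV2 ?posrE ?exprn_gt0 ?scale_gt0//.
by rewrite lerXn2r ?nnegrE ?(ltW x0) ?(ltW (scale_gt0 _)).
Qed.

End scales.
End kernel.

(** * Finitely supported measures *)

Section discrete_measures.
Context (R : realType) (T : choiceType) (A : set T) (k : T -> T -> R).
Implicit Types s : seq (R * T).

Definition discrete_on s :=
  (forall q, q \in s -> 0 <= q.1 /\ A q.2) /\ \sum_(q <- s) q.1 = 1.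

Definition discrete_potential s x := \sum_(q <- s) q.1 * k x q.2.

Definition discrete_energy s := \sum_(q <- s) q.1 * discrete_potential s q.2.

(* [(1 - t) s + t \d_x] *)
Definition mix_point t x s := (t, x) :: [seq ((1 - t) * q.1, q.2) | q <- s].

Hypothesis k_sym : forall x y, k x y = k y x.
Hypothesis k_diag : forall x, k x x = 1.

Lemma discrete_on_mix_point t x s :
  0 <= t <= 1 -> A x -> discrete_on s -> discrete_on (mix_point t x s).
Proof.
move=> /andP[t0 t1] Ax [s0 s1]; split=> [q|].
  rewrite inE => /orP[/eqP->//|/mapP[p ps ->]] /=; have [p0 Ap] := s0 _ ps.
  by rewrite mulr_ge0// subr_ge0.
by rewrite big_cons big_map/= -mulr_sumr s1 mulr1 subrKC.
Qed.

Lemma discrete_potential_mix_point t x s y :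
  discrete_potential (mix_point t x s) y =
  t * k y x + (1 - t) * discrete_potential s y.
Proof.
rewrite /discrete_potential big_cons big_map/= mulr_sumr; congr (_ + _).
by apply: eq_bigr => q _; rewrite mulrA.
Qed.

Lemma discrete_energy_mix_point t x s : discrete_on s ->
  discrete_energy (mix_point t x s) = (1 - t) ^+ 2 * discrete_energy s
    + 2 * t * (1 - t) * discrete_potential s x + t ^+ 2.
Proof.
move=> [_ s1]; rewrite {1}/discrete_energy big_cons big_map/=.
under eq_bigr do rewrite discrete_potential_mix_point.
rewrite discrete_potential_mix_point k_diag.
have -> : \sum_(q <- s) (1 - t) * q.1 * (t * k q.2 x + (1 - t) * discrete_potential s q.2)
   = (1 - t) * t * discrete_potential s x + (1 - t) ^+ 2 * discrete_energy s.
  rewrite /discrete_energy {2}/discrete_potential !mulr_sumr -big_split/=.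
  by apply: eq_bigr => q _; rewrite (k_sym q.2); ring.
ring.
Qed.

(* The first variation of the energy at a near-minimiser is nearly nonnegative,
   which bounds the potential from below at every point of [A]. *)
Lemma exists_potential_ge (g : R) : A !=set0 -> 0 < g ->
  (forall s, discrete_on s -> g <= discrete_energy s) ->
  exists2 s, discrete_on s & forall x, A x -> g / 2 <= discrete_potential s x.
Proof.
move=> [x0 Ax0] g0 hg.
have dx0 : discrete_on [:: (1, x0)].
  by split=> [q|]; rewrite ?big_seq1// inE => /eqP ->.
have ex0 : discrete_energy [:: (1, x0)] = 1.
  by rewrite /discrete_energy /discrete_potential !big_seq1/= k_diag !mul1r.
pose G := [set discrete_energy s | s in discrete_on].
have Glb : lbound G g by move=> _ [s ds <-]; exact: hg.
have infG : has_inf G by split; [exists 1, [:: (1, x0)]|exists g].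
have g1 : inf G <= 1 by apply: inf_lbound; [exact: infG.2|exists [:: (1, x0)]].
have ginf : g <= inf G by apply: lb_le_inf => //; exact: infG.1.
(* The energy of [s] is within [t^2] of [i = 3 t]. If the potential at [x] were below
   [g / 2 <= 3 t / 2], mixing in [x] with weight [t] would give energy below
   [3 t - t^2 - 2 t^3 + t^4 < i]. *)
set i := inf G in g1 ginf *; set t := i / 3.
have t0 : 0 < t by rewrite /t; lra.
have [_ [s ds <-] es] := inf_adherent (exprn_gt0 2 t0) infG.
exists s => // x Ax; rewrite leNgt; apply/negP => xs.
have : i <= discrete_energy (mix_point t x s).
  apply: inf_lbound; first exact: infG.2.
  exists (mix_point t x s) => //; apply: discrete_on_mix_point => //.
  by rewrite ltW//= /t; lra.
rewrite discrete_energy_mix_point//.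
move: es; rewrite -/i; have -> : i = 3 * t by rewrite /t; field.
have t3 : t <= 1 / 3 by rewrite /t; lra.
have {}xs : discrete_potential s x < 3 * t / 2.
  by apply: lt_le_trans xs _; rewrite /t; lra.
set e := discrete_energy s; set u := discrete_potential s x in xs *.
move=> es; apply/negP; rewrite -ltNge.
have : (1 - t) ^+ 2 * e <= (1 - t) ^+ 2 * (3 * t + t ^+ 2).
  by rewrite ler_wpM2l ?sqr_ge0// ltW.
have : 2 * t * (1 - t) * u <= 2 * t * (1 - t) * (3 * t / 2).
  by apply: ler_wpM2l; [rewrite !mulr_ge0//; lra|exact: ltW].
have : 0 < t ^+ 2 by exact: exprn_gt0.
have : 0 <= t ^+ 2 * t by rewrite mulr_ge0 ?sqr_ge0// ltW.
have : 0 <= t ^+ 2 * t * (1 - t) by rewrite !mulr_ge0 ?sqr_ge0//; lra.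
nra.
Qed.

End discrete_measures.

(** * From potentials to covers *)

Section grid.
Context (R : realType) (n : nat).
Implicit Types (x y : 'rV[R]_n) (h a : R) (z : {ffun 'I_n -> int}).

Definition cell h x : {ffun 'I_n -> int} :=
  [ffun i => Num.floor (x ord0 i / h)].

(** Closed on both sides, so that opposite corners belong to it and the diameter is exact; covers
    bound diameters from below as well as from above. *)
Definition cube h z : set 'rV[R]_n :=
  [set x | forall i, (z i)%:~R * h <= x ord0 i <= (z i)%:~R * h + h].

Lemma cube_cell h x : 0 < h -> cube h (cell h x) x.
Proof.
move=> h0 i; rewrite ffunE; have /andP[] := floor_itv (x ord0 i / h).
rewrite ler_pdivlMr// => -> /=; rewrite intrD ltr_pdivrMr// => /ltW.
by rewrite mulrDl mul1r.
Qed.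

Lemma diam_cube h z : 0 < h -> diam (cube h z) = (Num.sqrt n%:R * h)%:E.
Proof.
move=> h0; apply/eqP; rewrite eq_le; apply/andP; split.
  apply/diam_le; first by rewrite mulr_ge0 ?sqrtr_ge0// ltW.
  move=> x y xz yz; apply: enorm_le_box; last exact: ltW.
  move=> i; rewrite !mxE ler_norml; have := xz i; have := yz i; lra.
pose lo : 'rV[R]_n := \row_i ((z i)%:~R * h).
rewrite /diam le_max; apply/orP; right.
apply: ereal_sup_ubound; exists (lo + const_mx h, lo).
  by split=> i; rewrite !mxE; lra.
by rewrite /= addrAC subrr add0r enorm_const// ltW.
Qed.

(** In each coordinate the cell index exceeds [m i] by an integer between 0 and [T], so cells inject
    into functions from ['I_n] to ['I_T.+1]. *)
Lemma size_cells_le h a y (zs : seq {ffun 'I_n -> int}) :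
  0 < h -> 0 <= a -> uniq zs ->
  (forall z, z \in zs -> exists2 x, cell h x = z & enorm (x - y) <= a) ->
  (size zs)%:R <= (2 * a / h + 2) ^+ n.
Proof.
move=> h0 a0 uzs hzs.
pose m i : int := Num.floor ((y ord0 i - a) / h).
pose T := Num.truncn (2 * a / h + 1).
have zm z i : z \in zs -> 0 <= z i - m i /\ (`|z i - m i|%N <= T)%N.
  move=> /hzs[x <- xy]; rewrite ffunE.
  have := le_trans (normr_coord_le_enorm _ i) xy.
  rewrite !mxE ler_norml => /andP[xy1 xy2].
  have zm0 : 0 <= Num.floor (x ord0 i / h) - m i.
    rewrite subr_ge0 le_floor// ler_pM2r ?invr_gt0//; lra.
  split=> //.
  rewrite truncn_ge_nat ?addr_ge0 ?divr_ge0 ?mulr_ge0 ?(ltW h0)//.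
  rewrite natr_absz ger0_norm// intrB.
  have /andP[_] := floor_itv ((y ord0 i - a) / h); rewrite -/(m i) intrD => mi.
  have fx := floor_le (x ord0 i / h).
  have : x ord0 i / h <= (y ord0 i - a) / h + 2 * a / h.
    by rewrite -mulrDl ler_pM2r ?invr_gt0//; lra.
  move: mi fx; rewrite (_ : 1%:~R = 1)//; lra.
pose f z : {ffun 'I_n -> 'I_T.+1} := [ffun i => inord `|z i - m i|%N].
have f_inj : {in zs &, injective f}.
  move=> z1 z2 z1zs z2zs /ffunP f12; apply/ffunP => i.
  have [p1 q1] := zm _ i z1zs; have [p2 q2] := zm _ i z2zs.
  have := f12 i; rewrite !ffunE => /(congr1 val); rewrite /= !inordK//.
  move=> /(congr1 Posz); rewrite !abszE !ger0_norm// => /(congr1 (+%R^~ (m i))).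
  by rewrite !subrK.
have : (size zs <= T.+1 ^ n)%N.
  rewrite -(size_map f) -[n in leqRHS]card_ord -[T.+1 in leqRHS]card_ord -card_ffun.
  rewrite cardE; apply: uniq_leq_size => [|u _]; last by rewrite mem_enum.
  by rewrite map_inj_in_uniq.
rewrite -(ler_nat R) natrX => /le_trans; apply.
apply: lerXn2r; rewrite ?nnegrE ?addr_ge0 ?divr_ge0 ?mulr_ge0 ?(ltW h0)//.
have := truncn_le (2 * a / h + 1); rewrite ?addr_ge0 ?divr_ge0 ?mulr_ge0 ?(ltW h0)//.
by rewrite -/T -natr1 => /idP T1; lra.
Qed.

End grid.

(** * Covers built from a near-minimiser of the energy *)

Section cover_of_capacity.
Context (R : realType) (n : nat).

(* Double counting: every cell of the level carries potential at least [lev], and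
   each atom of [p] contributes to few cells. *)
Lemma size_level_cells_le (p : seq (R * 'rV[R]_n)) (F : set 'rV[R]_n)
    (a h w lev : R) (zs : seq {ffun 'I_n -> int}) :
  (forall q, q \in p -> 0 <= q.1) -> \sum_(q <- p) q.1 = 1 ->
  0 < h -> 0 <= a -> 0 <= w ->
  (forall x, F x -> lev <= w * \sum_(q <- p) q.1 * (enorm (x - q.2) < a)%R%:R) ->
  uniq zs -> (forall z, z \in zs -> exists2 x, F x & cell h x = z) ->
  (size zs)%:R * lev <= w * (2 * a / h + 2) ^+ n.
Proof.
move=> p0 p1 h0 a0 w0 hF uzs hzs.
pose X z := xget 0 [set x | F x /\ cell h x = z].
have XP z : z \in zs -> F (X z) /\ cell h (X z) = z.
  by move=> /hzs[x Fx xz]; apply: (@xgetPex _ 0 [set x | F x /\ cell h x = z]); exists x.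
have -> : (size zs)%:R * lev = \sum_(z <- zs) lev.
  by rewrite big_const_seq count_predT -Monoid.iteropE /= mulr_natl.
apply: (@le_trans _ _ (\sum_(z <- zs) w * \sum_(q <- p) q.1 * (enorm (X z - q.2) < a)%R%:R)).
  by rewrite !big_seq; apply: ler_sum => z /XP[Fz _]; exact: hF.
rewrite -mulr_sumr exchange_big/=; apply: ler_wpM2l => //.
set B := leRHS; have -> : B = \sum_(q <- p) q.1 * B by rewrite -mulr_suml p1 mul1r.
rewrite !big_seq; apply: ler_sum => q qp.
rewrite -mulr_sumr; apply: ler_wpM2l; first exact: p0.
rewrite -natr_sum.
have -> : (\sum_(z <- zs) (enorm (X z - q.2) < a)%R)%N =
          size [seq z <- zs | enorm (X z - q.2) < a].
  rewrite size_filter -sum1_count [RHS]big_mkcond/=.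
  by apply: eq_bigr => z _; case: ifP.
apply: (@size_cells_le _ _ _ _ q.2) => //; first exact: filter_uniq.
move=> z; rewrite mem_filter => /andP[za /XP[_ Xz]].
by exists (X z) => //; exact: ltW.
Qed.

Context (r theta s : R) (K : nat) (E : set 'rV[R]_n).
Hypotheses (n_gt0 : (0 < n)%N) (r_gt0 : 0 < r) (r_lt1 : r < 1).
Hypotheses (theta_gt0 : 0 < theta) (theta_le1 : theta <= 1).
Hypotheses (s_ge0 : 0 <= s) (s_le : s <= n%:R) (K_gt0 : (0 < K)%N).
Hypothesis E_small : forall x y, E x -> E y -> enorm (x - y) < r^-1.

Local Notation phi := (@kernel_phi R n r theta s n).
Local Notation a := (scale r K).
Local Notation b := (cell_diam r theta K).
Local Notation w := (scale_weight n r theta s K).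

(** In the constant, 2 comes from the potential bound [g / 2], one factor [K + 1] from the share of
    a scale, the other from summing over scales, and the [n]-th power from counting cells. *)
Lemma has_cover_of_discrete_energy (g : R) : E !=set0 -> 0 < g ->
  (forall p, discrete_on E p -> g <= discrete_energy (fun x y => phi (x - y)) p) ->
  has_cover theta E s
    (2 * K.+1%:R ^+ 2 * (2 * Num.sqrt n%:R + 2) ^+ n * r `^ (s - 2 * n%:R / K%:R) / g)
    (r `^ theta).
Proof.
move=> E0 g0 hg.
have [||p [pE p1] hp] := exists_potential_ge _ _ E0 g0 hg.
  by move=> x y; exact: kernel_distC.
  by move=> x; rewrite subrr kernel0.
have K1 : 0 < K.+1%:R :> R by rewrite ltr0n.
(* Pigeonhole: at each point of [E] one of the [K + 1] scales carries a fair share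
   of the potential; [F k] collects the points for which scale [k] does. *)
pose lev : R := g / 2 / K.+1%:R.
pose F k : set 'rV[R]_n := [set x | E x /\
  lev <= w k * \sum_(q <- p) q.1 * (enorm (x - q.2) < a k)%R%:R].
have EF x : E x -> exists2 k, (k <= K)%N & F k x.
  move=> Ex; apply: contrapT => nF.
  have : \sum_(k < K.+1) w k * (\sum_(q <- p) q.1 * (enorm (x - q.2) < a k)%R%:R) <
         \sum_(k < K.+1) lev.
    apply: ltr_sum => [|k _].
      by apply/hasP; exists ord0; rewrite ?mem_index_enum.
    rewrite ltNge; apply/negP => levk; apply: nF.
    by exists k => //; rewrite -ltnS ltn_ord.
  rewrite sumr_const card_ord -mulr_natr divfK ?gt_eqF// ltNge => /negP; apply.
  apply: le_trans (hp _ Ex) _.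
  under [leRHS]eq_bigr do rewrite mulr_sumr.
  rewrite exchange_big/= /discrete_potential !big_seq; apply: ler_sum => q qp.
  have [q0 Eq] := pE _ qp.
  have [k [kK xk phik]] :=
    kernel_le_scale_weight r_gt0 r_lt1 theta_le1 s_le K_gt0 (E_small Ex Eq).
  rewrite (bigD1 (Ordinal (kK : (k < K.+1)%N)))//= xk mulr1.
  rewrite -[leLHS]addr0 lerD//; first by rewrite mulrC ler_wpM2r.
  by apply: sumr_ge0 => j _; rewrite mulr_ge0 ?scale_weight_ge0// mulr_ge0.
have sn0 : 0 < Num.sqrt n%:R :> R by rewrite sqrtr_gt0 ltr0n.
(* This side length gives cubes of diameter exactly [b k]. *)
pose h k := b k / Num.sqrt n%:R.
have b0 k : 0 < b k by exact: cell_diam_gt0.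
have h0 k : 0 < h k by rewrite divr_gt0.
(* Pairs of a scale and a cell are coded as natural numbers. Numbers that are not codes get dummy
   values and stay outside [D], which keeps only cells meeting [F k]. *)
pose U i : set 'rV[R]_n :=
  if (choice.unpickle i : option (nat * {ffun 'I_n -> int})) is Some kz
  then cube (h kz.1) kz.2 else set0.
pose lvl i := if (choice.unpickle i : option (nat * {ffun 'I_n -> int})) is Some kz
  then kz.1 else 0%N.
pose cel i := if (choice.unpickle i : option (nat * {ffun 'I_n -> int})) is Some kz
  then kz.2 else [ffun=> 0].
pose D : set nat := [set i | exists k x, [/\ (k <= K)%N, F k x &
  i = choice.pickle (k, cell (h k) x)]].
have UD i : D i -> diam (U i) = (b (lvl i))%:E.
  move=> [k [x [_ _ ->]]]; rewrite /U /lvl choice.pickleK/= diam_cube// /h.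
  by rewrite mulrC divfK// gt_eqF.
exists D, U; split.
- move=> x /EF[k kK Fx]; exists (choice.pickle (k, cell (h k) x)); first by exists k, x.
  by rewrite /U choice.pickleK/=; exact: cube_cell.
- move=> i Di; rewrite UD// !lee_fin; split; last exact: cell_diam_le.
  by rewrite -powRrM divff ?gt_eqF// powRr1 ?(ltW r_gt0)// cell_diam_ge.
(* The cover sum is the supremum of its finite partial sums. Each is grouped by scale, and every
   scale contributes at most [M]. *)
apply: ge_ereal_sup => _ [X [finX XD] <-].
rewrite fsbig_finite//=.
set l := enum_fset _.
have lD i : i \in l -> D i by move=> il; apply: XD; rewrite -(fset_setK finX).
have ul : uniq l by exact: fset_uniq.
rewrite big_seq; under eq_bigr => i /lD Di do rewrite UD//=.
rewrite -big_seq sumEFin lee_fin.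
have lK i : i \in l -> (lvl i < K.+1)%N.
  by move=> /lD[k [x [kK _ ->]]]; rewrite /lvl choice.pickleK.
have -> : \sum_(i <- l) b (lvl i) `^ s =
    \sum_(k < K.+1) \sum_(i <- l | lvl i == k) b k `^ s.
  under [RHS]eq_bigr do rewrite big_mkcond.
  rewrite exchange_big/= !big_seq; apply: eq_bigr => i il.
  rewrite (bigD1 (Ordinal (lK _ il)))//= eqxx big1 ?addr0// => j ji.
  by case: ifPn => // /eqP ij; case/eqP: ji; apply: val_inj; rewrite /= ij.
pose M := 2 * K.+1%:R * (2 * Num.sqrt n%:R + 2) ^+ n * r `^ (s - 2 * n%:R / K%:R) / g.
have -> : 2 * K.+1%:R ^+ 2 * (2 * Num.sqrt n%:R + 2) ^+ n * r `^ (s - 2 * n%:R / K%:R) / g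
    = \sum_(k < K.+1) M.
  by rewrite sumr_const card_ord -[M *+ _]mulr_natr /M expr2; field; rewrite gt_eqF.
apply: ler_sum => k _.
pose zs := [seq cel i | i <- l & lvl i == k].
have -> : \sum_(i <- l | lvl i == k) b k `^ s = (size zs)%:R * b k `^ s.
  rewrite big_const_seq -Monoid.iteropE/= size_map size_filter mulr_natl//.
have zs_le : (size zs)%:R * lev <= w k * (2 * a k / h k + 2) ^+ n.
  apply: (@size_level_cells_le p (F k)) => //.
  - by move=> q /pE[].
  - exact/ltW/scale_gt0.
  - exact: scale_weight_ge0.
  - by move=> x [].
  - rewrite map_inj_in_uniq ?filter_uniq// => i j; rewrite !mem_filter.
    move=> /andP[/eqP ki /lD Di] /andP[/eqP kj /lD Dj].
    move: Di Dj ki kj => [k1 [x1 [_ _ ->]]] [k2 [x2 [_ _ ->]]].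
    by rewrite /lvl /cel !choice.pickleK/= => -> -> ->.
  - move=> z /mapP[i]; rewrite mem_filter => /andP[/eqP ki /lD].
    move: ki => /[swap] -[k1 [x [_ Fx ->]]]; rewrite /lvl /cel !choice.pickleK/= => k1k ->.
    by exists x; rewrite -k1k.
have lev0 : 0 < lev by rewrite !divr_gt0.
have ab : b k <= a k by rewrite ge_min lexx.
(* Since [b k <= a k], the additive 2 is absorbed into a multiple of [a k / b k]. *)
have cell_count : 2 * a k / h k + 2 <= (2 * Num.sqrt n%:R + 2) * (a k / b k).
  have -> : (2 * Num.sqrt n%:R + 2) * (a k / b k) = 2 * a k / h k + 2 * (a k / b k).
    by rewrite /h; field; rewrite !gt_eqF.
  by rewrite lerD2l ler_peMr// ler_pdivlMr// mul1r.
rewrite -(ler_pM2r lev0) mulrAC.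
apply: (@le_trans _ _ (w k * ((2 * Num.sqrt n%:R + 2) * (a k / b k)) ^+ n * b k `^ s)).
  rewrite ler_wpM2r ?powR_ge0//; apply: le_trans zs_le _.
  rewrite ler_wpM2l ?scale_weight_ge0// lerXn2r// nnegrE.
    by rewrite addr_ge0// divr_ge0 ?mulr_ge0// ltW// scale_gt0.
  have ab0 : 0 <= a k / b k by rewrite divr_ge0// ltW// scale_gt0.
  by rewrite mulr_ge0// addr_ge0// mulr_ge0// sqrtr_ge0.
rewrite exprMn.
have -> (c x : R) : w k * (c * x) * b k `^ s = c * (w k * x * b k `^ s) by ring.
rewrite scale_weightE// /M /lev le_eqVlt; apply/orP; left; apply/eqP.
by field; rewrite !gt_eqF.
Qed.

End cover_of_capacity.

(** * From covers to energies *)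

Section capacity_bounds.
Context (R : realType) (n : nat).
Implicit Types (E W : set 'rV[R]_n).

(** At most [M / c] terms fit. As diameters are at least [r], covers with a bounded sum are finite,
    as [energy_ge_inv_sum] requires. *)
Lemma finite_esum_ge (D : set nat) (f : nat -> \bar R) (c M : R) : 0 < c ->
  (forall i, D i -> (c%:E <= f i)%E) -> (\esum_(i in D) f i <= M%:E)%E ->
  finite_set D.
Proof.
move=> c0 fc fM; apply: contrapT => infD.
have [B BD szB] := infinite_set_fset (Num.truncn (M / c)).+1 infD.
have : (M%:E < M%:E)%E; last by rewrite ltxx.
apply: lt_le_trans fM; apply: (@lt_le_trans _ _ ((size (enum_fset B))%:R * c)%:E).
  rewrite lte_fin -ltr_pdivrMr//; apply: lt_le_trans (truncnS_gt _) _.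
  by rewrite ler_nat.
apply: esum_ge; exists [set` B]; first by split=> //; exact: finite_fset.
rewrite fsbig_finite//= set_fsetK.
have -> : ((size (enum_fset B))%:R * c)%:E = (\sum_(i <- enum_fset B) c%:E)%E.
  by rewrite sumEFin big_const_seq count_predT -Monoid.iteropE /= mulr_natl.
by rewrite !big_seq; apply: lee_sum => i iB; exact/fc/BD.
Qed.

Lemma measurable_closed_borel_rV W : closed W -> measurable (W : set (borel_rV R n)).
Proof.
move=> cW; rewrite -(setCK W); apply: measurableC.
by apply: sub_gen_smallest; exact: closed_openC.
Qed.

Lemma probability_on_closed_superset E W (mu : probability (borel_rV R n) R) :
  closed E -> closed W -> E `<=` W -> probability_on E mu -> mu W = 1%E.
Proof.
move=> cE cW EW muE.
have mE := measurable_closed_borel_rV cE; have mW := measurable_closed_borel_rV cW.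
have mu1 : mu E = 1%E.
  by rewrite -(setCK E) probability_setC ?muE ?sube0//; exact: measurableC.
apply/eqP; rewrite eq_le probability_le1//= -mu1.
by apply: le_measure; rewrite ?inE.
Qed.

Context (r theta s : R) (E : set 'rV[R]_n).
Hypotheses (r_gt0 : 0 < r) (r_lt1 : r < 1).
Hypotheses (theta_gt0 : 0 < theta) (theta_le1 : theta <= 1).
Hypotheses (s_ge0 : 0 <= s) (s_le : s <= n%:R).

Local Notation phi := (@kernel_phi R n r theta s n).

(** At scale [r^theta] the diameters lie in [[r, r^theta]], so [kernel_ge_ball] applies on the
    closures of the covering sets, with [c i = (r / |U_i|)^s]. *)
Lemma energy_ge_of_cover (M : R) (mu : probability (borel_rV R n) R) :
  0 < M -> has_cover theta E s M (r `^ theta) -> probability_on (closure E) mu ->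
  ((r `^ s / M)%:E <= energy r theta s n mu)%E.
Proof.
move=> M0 [D [U [EU diamU sumU]]] muE.
have rK : (r `^ theta) `^ theta^-1 = r.
  by rewrite -powRrM divff ?gt_eqF// powRr1// ltW.
rewrite rK in diamU.
have finD : finite_set D.
  apply: (finite_esum_ge (powR_gt0 s r_gt0) _ sumU) => i /diamU[rd dr].
  case: (diam (U i)) rd dr => [d| |]//; rewrite !lee_fin => rd _.
  by rewrite ge0_ler_powR// nnegrE ltW// (lt_le_trans r_gt0).
pose l := enum_fset (fset_set D).
have lD i : i \in l -> D i by move=> il; rewrite -(fset_setK finD).
have Dl i : D i -> i \in l by move=> Di; rewrite /l in_fset_set// inE.
(* On [D] this is the diameter; the maximum keeps it positive at every index. *)
pose delta i := Num.max r (fine (diam (U i))).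
have dE i : D i -> diam (U i) = (delta i)%:E.
  move=> /diamU[]; rewrite /delta; case: (diam _) => // d; rewrite !lee_fin /= => rd _.
  by rewrite (max_idPr rd).
have d0 i : 0 < delta i by rewrite lt_max r_gt0.
pose W i := closure (U (nth 0%N l i)).
pose c i := (r / delta (nth 0%N l i)) `^ s.
have c0 i : 0 < c i by rewrite powR_gt0// divr_gt0.
have cW i : closed (W i) by exact: closed_closure.
have k0 (x y : borel_rV R n) : (0 <= (phi ((x : 'rV[R]_n) - (y : 'rV[R]_n)))%:E)%E.
  by rewrite lee_fin kernel_ge0.
have mW i : measurable (W i : set (borel_rV R n)).
  exact: measurable_closed_borel_rV.
have kc i (x y : borel_rV R n) : (i < size l)%N -> W i x -> W i y ->
    ((c i)%:E <= (phi ((x : 'rV[R]_n) - (y : 'rV[R]_n)))%:E)%E.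
  move=> il Wx Wy; have Di := lD _ (mem_nth 0%N il).
  have [rd drho] := diamU _ Di; rewrite dE// !lee_fin in rd drho.
  rewrite lee_fin kernel_ge_ball//.
  apply: enorm_sub_le_closure Wx Wy; apply/diam_le; first exact: ltW.
  by rewrite dE.
have muW : mu (\big[setU/set0]_(i < size l) W i) = 1%E.
  apply: probability_on_closed_superset muE => //; first exact: closed_closure.
    by apply: closed_bigsetU => i _; exact: cW.
  have cWU : closed (\big[setU/set0]_(i < size l) W i).
    by apply: closed_bigsetU => i _; exact: cW.
  move=> x Ex; apply: cWU; apply: closureS Ex => {}x /EU[i Di Uix].
  have il : (index i l < size l)%N by rewrite index_mem Dl.
  rewrite -bigcup_mkord; exists (index i l) => //=.
  by rewrite /W nth_index ?Dl//; exact: subset_closure.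
apply: le_trans (energy_ge_inv_sum k0 mW c0 kc muW).
have sumc : \sum_(i < size l) (c i)^-1 <= M / r `^ s.
  have -> : \sum_(i < size l) (c i)^-1 = (\sum_(i <- l) delta i `^ s) / r `^ s.
    rewrite (big_nth 0%N) big_mkord mulr_suml; apply: eq_bigr => i _.
    have d0i := ltW (d0 (nth 0%N l i)).
    rewrite /c powRM ?(ltW r_gt0) ?invr_ge0// -[(delta _)^-1]powR_inv1//.
    by rewrite -powRrM mulN1r powRN invf_div.
  rewrite ler_pM2r ?invr_gt0 ?powR_gt0// -lee_fin.
  apply: le_trans sumU; rewrite esum_fset//; last by move=> i _; exact: poweR_ge0.
  rewrite fsbig_finite//= -sumEFin -/l !big_seq; apply: lee_sum => i il.
  by rewrite (dE _ (lD _ il)).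
rewrite lee_fin -invf_div lef_pV2 ?posrE ?divr_gt0 ?powR_gt0//.
(* Inverting the inequality needs a positive sum. The family is non-empty because its union has
   measure 1. *)
have [i0 i0l] : exists i0, (i0 < size l)%N.
  apply: contrapT => nl; have l0 : size l = 0%N.
    by apply/eqP; rewrite -leqn0 leqNgt; apply/negP => l0; apply: nl; exists 0%N.
  by move: muW; rewrite l0 big_ord0 measure0 => /eqP; rewrite eq_sym onee_eq0.
rewrite (bigD1 (Ordinal i0l))//= ltr_pwDl ?invr_gt0// sumr_ge0// => i _.
by rewrite invr_ge0 ltW.
Qed.

Definition min_energy : \bar R :=
  ereal_inf [set energy r theta s n mu | mu in probability_on (closure E)].

(** The case of [energy_ge_inv_sum] with the single set [closure E]. *)
Lemma min_energy_ge (d : R) : 1 <= d ->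
  (forall x y, E x -> E y -> enorm (x - y) <= d) ->
  (((r / d) ^+ n)%:E <= min_energy)%E.
Proof.
move=> d1 Ed; apply/ereal_infP => _ [mu muE <-].
have d0 : 0 < d by exact: lt_le_trans d1.
have k0 (x y : borel_rV R n) : (0 <= (phi ((x : 'rV[R]_n) - (y : 'rV[R]_n)))%:E)%E.
  by rewrite lee_fin kernel_ge0.
have cE : closed (closure E) by exact: closed_closure.
have := @energy_ge_inv_sum _ _ _ mu _ 1 (fun=> closure E) (fun=> (r / d) ^+ n) k0.
rewrite !big_ord_recl !big_ord0 setU0 addr0 invrK; apply.
- by move=> _; exact: measurable_closed_borel_rV.
- by move=> _; rewrite exprn_gt0// divr_gt0.
- move=> _ x y _ Ex Ey; rewrite lee_fin kernel_ge_pow//.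
  exact: enorm_sub_le_closure Ex Ey.
- exact: probability_on_closed_superset muE.
Qed.

Lemma min_energy_le_discrete (p : seq (R * 'rV[R]_n)) : discrete_on E p ->
  (min_energy <= (discrete_energy (fun x y => phi (x - y)) p)%:E)%E.
Proof.
move=> [pE p1].
have [|||mu [muE mu_le]] := @discrete_probability _ (borel_rV R n) R p (closure E) _ p1.
- by move=> q /pE[].
- by apply: measurable_closed_borel_rV; exact: closed_closure.
- by move=> q /pE[_ Eq]; exact: subset_closure.
apply: (@le_trans _ _ (energy r theta s n mu)).
  by apply: ereal_inf_lbound; exists mu.
have k0 (x y : borel_rV R n) : (0 <= (phi ((x : 'rV[R]_n) - (y : 'rV[R]_n)))%:E)%E.
  by rewrite lee_fin kernel_ge0.
apply: le_trans (mu_le _ _) _.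
  by move=> y; apply: integral_ge0 => x _; exact: k0.
rewrite /discrete_energy -sumEFin !big_seq; apply: lee_sum => q qp.
have [q0 Eq] := pE _ qp.
rewrite EFinM lee_wpmul2l// ?lee_fin//.
apply: (le_trans (mu_le (fun x => (phi ((x : 'rV[R]_n) - q.2))%:E) (k0^~ q.2))).
rewrite /discrete_potential -sumEFin !big_seq; apply: lee_sum => q' _.
by rewrite EFinM kernel_distC.
Qed.

(** A point mass has energy equal to the kernel at 0. *)
Lemma min_energy_le1 : E !=set0 -> (min_energy <= 1)%E.
Proof.
move=> [x Ex]; have dx : discrete_on E [:: (1 : R, x)].
  by split=> [q|]; rewrite ?big_seq1// inE => /eqP ->.
apply: le_trans (min_energy_le_discrete dx) _.
by rewrite /discrete_energy /discrete_potential !big_seq1/= subrr kernel0// !mul1r.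
Qed.

End capacity_bounds.

(** * Dimensions and profiles *)

Section asymptotics.
Context (R : realType) (n : nat) (theta : R) (E : set 'rV[R]_n).
Hypotheses (theta_gt0 : 0 < theta) (theta_le1 : theta <= 1).

Lemma has_cover_change_exponent (s t c M r : R) : 0 <= c ->
  (forall delta, r `^ theta^-1 <= delta -> delta <= r ->
    delta `^ t <= c * delta `^ s) ->
  has_cover theta E s M r -> has_cover theta E t (c * M) r.
Proof.
move=> c0 hc [D [U [EU diamU sumU]]]; exists D, U; split=> //.
apply: ge_ereal_sup => _ [X [finX XD] <-].
apply: (@le_trans _ _ (c%:E * (\sum_(i \in X) poweR (diam (U i)) s)%R)%E); last first.
  rewrite EFinM lee_wpmul2l ?lee_fin//.
  by apply: le_trans sumU; apply: ereal_sup_ubound; exists X.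
rewrite !fsbig_finite//= ge0_sume_distrr; last by move=> i _; exact: poweR_ge0.
rewrite !big_seq; apply: lee_sum => i.
rewrite in_fset_set// inE => /XD /diamU.
case: (diam (U i)) => [d| |] []//; rewrite !lee_fin => dr rd /=.
exact: hc.
Qed.

Lemma has_coverW (s M M' r : R) : M <= M' ->
  has_cover theta E s M r -> has_cover theta E s M' r.
Proof.
move=> MM' [D [U [EU diamU sumU]]]; exists D, U; split=> //.
by apply: le_trans sumU _; rewrite lee_fin.
Qed.

Lemma has_cover_ler_exponent (s t M r : R) : 0 < r -> s <= t ->
  has_cover theta E s M r -> has_cover theta E t (r `^ (t - s) * M) r.
Proof.
move=> r0 st; apply: has_cover_change_exponent; first exact: powR_ge0.
move=> d rd dr; have d0 : 0 < d by apply: lt_le_trans rd; exact: powR_gt0.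
rewrite -[t in leLHS](subrK s) (powRD_gt0 _ _ d0) ler_wpM2r ?powR_ge0//.
by rewrite ge0_ler_powR ?subr_ge0// nnegrE ltW.
Qed.

Hypothesis E0 : E !=set0.
Context (d : R).
Hypotheses (d_ge1 : 1 <= d) (E_le : forall x y, E x -> E y -> enorm (x - y) <= d).

(** The bounds on [min_energy] place it in [(0, 1]], so the logarithm is finite; then [- ln r > 0]
    turns the ratio into a comparison of powers, the form used from here on. *)
Lemma log_capacity_ratio_le (r s a : R) :
  0 < r -> r < 1 -> 0 <= s -> s <= n%:R ->
  (log_capacity_ratio theta s n E r <= a%:E)%E =
  ((r `^ a)%:E <= min_energy r theta s E)%E.
Proof.
move=> r0 r1 s0 sn.
have gd := min_energy_ge r0 r1 theta_le1 sn d_ge1 E_le.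
have g1 := min_energy_le1 theta s r0 E0.
rewrite /log_capacity_ratio /capacity /compact_capacity -/(min_energy r theta s E).
case: (min_energy _ _ _ _) gd g1 => [g| |]//; rewrite !lee_fin => gd g1.
have d0 : 0 < d by exact: lt_le_trans d_ge1.
have g0 : 0 < g by apply: lt_le_trans gd; rewrite exprn_gt0// divr_gt0.
have lnr : ln r < 0 by rewrite ln_lt0// r0.
rewrite inver gt_eqF// lne_EFin ?invr_gt0// inver gt_eqF ?oppr_gt0// -EFinM lee_fin.
rewrite lnV ?posrE// invrN mulrNN -[RHS]ler_ln ?posrE ?powR_gt0// ln_powR.
by rewrite ler_ndivrMr.
Qed.

End asymptotics.

Lemma powR_eventually_le (R : realType) (C b e : R) : 0 < C -> 0 < b -> 0 < e ->
  exists2 r0, 0 < r0 & forall r, 0 < r -> r < r0 -> C * r `^ b <= e.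
Proof.
move=> C0 b0 e0; exists ((e / C) `^ b^-1); first by rewrite powR_gt0 ?divr_gt0.
move=> r rgt0 rlt; rewrite mulrC -ler_pdivlMr//.
have -> : e / C = ((e / C) `^ b^-1) `^ b.
  by rewrite -powRrM mulVf ?gt_eqF// powRr1// ltW// divr_gt0.
by rewrite ge0_ler_powR ?nnegrE ?powR_ge0 ?(ltW b0)// ltW.
Qed.

(* [Q] stands for "for arbitrarily small [r]" (lower dimensions) or "for all
   small [r]" (upper dimensions), and [lim] for the lower, resp. upper, limit. *)
Section profile.
Context (R : realType) (n : nat) (theta : R) (E : set 'rV[R]_n).
Hypotheses (n_gt0 : (0 < n)%N) (E0 : E !=set0) (E_bounded : bounded_set E).
Hypotheses (theta_gt0 : 0 < theta) (theta_le1 : theta <= 1).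
Context (Q : (R -> Prop) -> Prop) (lim : (R -> \bar R) -> \bar R).
Hypothesis Q_mono : forall P P' : R -> Prop,
  (exists2 r0, 0 < r0 & forall r, 0 < r -> r < r0 -> P r -> P' r) -> Q P -> Q P'.
(** Kernels at scale [r] correspond to covers at scale [r^theta]. *)
Hypothesis Q_powR : forall P, Q (fun r => P (r `^ theta)) <-> Q P.
Hypothesis Q_True : Q (fun=> True).
Hypothesis Q_False : ~ Q (fun=> False).
(** The gap [b < a] becomes a positive power of [r] that beats all constants. *)
Hypothesis lim_lt : forall f a, (lim f < a%:E)%E ->
  exists2 b, b < a & Q (fun r => (f r <= b%:E)%E).
Hypothesis lim_le : forall f a, Q (fun r => (f r <= a%:E)%E) -> (lim f <= a%:E)%E.

Local Notation ratio s := (log_capacity_ratio theta s n E).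

Let A : set R := [set s | 0 <= s /\ forall eps, 0 < eps -> Q (has_cover theta E s eps)].

Let exists_diam : exists2 d : R, 1 <= d & forall x y, E x -> E y -> enorm (x - y) <= d.
Proof. exact: bounded_enorm_sub. Qed.

Let A_up s t : A s -> s <= t -> A t.
Proof.
move=> [s0 As] st; split=> [|eps eps0]; first exact: le_trans st.
apply: Q_mono (As _ eps0); exists 1 => // r r0 r1.
move=> /(has_cover_ler_exponent r0 st); apply: has_coverW.
rewrite ler_piMl ?(ltW eps0)// -[leRHS](powRr0 r) ger_powR ?r0 ?(ltW r1)//.
by rewrite subr_ge0.
Qed.

(** Here [delta^(t - s)] is largest at [delta = r^theta]: raising the exponent gains a power of
    [r]. *)
Let pow_up s t : s <= t -> forall r delta : R, 0 < r -> r < 1 -> r <= delta ->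
  delta <= r `^ theta -> delta `^ t <= r `^ (theta * (t - s)) * delta `^ s.
Proof.
move=> st r delta r0 r1 rd drho; have d0 : 0 < delta by exact: lt_le_trans rd.
rewrite -[t in leLHS](subrK s) (powRD_gt0 _ _ d0) ler_wpM2r ?powR_ge0// powRrM.
by rewrite ge0_ler_powR ?subr_ge0// nnegrE ltW// powR_gt0.
Qed.

(** Now [t - s <= 0], so [delta^(t - s)] is largest at [delta = r]. *)
Let pow_down s t : t <= s -> forall r delta : R, 0 < r -> r < 1 -> r <= delta ->
  delta <= r `^ theta -> delta `^ t <= r `^ (t - s) * delta `^ s.
Proof.
move=> ts r delta r0 r1 rd drho; have d0 : 0 < delta by exact: lt_le_trans rd.
rewrite -[t in leLHS](subrK s) (powRD_gt0 _ _ d0) ler_wpM2r ?powR_ge0//.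
rewrite -opprB !powRN lef_pV2 ?posrE ?powR_gt0//.
by rewrite ge0_ler_powR ?subr_ge0// nnegrE ltW.
Qed.

(** A cover with sum at most 1 at exponent [t] has sum at most [r^c] at exponent [s], so every
    energy is at least [r^(s - c)]. *)
Let lim_ratio_le_of_cover t s c : 0 <= t -> 0 <= s -> s <= n%:R ->
  (forall r delta, 0 < r -> r < 1 -> r <= delta -> delta <= r `^ theta ->
     delta `^ s <= r `^ c * delta `^ t) ->
  Q (has_cover theta E t 1) -> (lim (ratio s) <= (s - c)%:E)%E.
Proof.
move=> t0 s0 sn hc /(Q_powR (has_cover theta E t 1)).2 Qt; apply: lim_le; apply: Q_mono Qt.
have [d d1 Ed] := exists_diam.
exists 1 => // r r0 r1 cov.
rewrite (log_capacity_ratio_le theta_le1 E0 d1 Ed)//.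
have rK : (r `^ theta) `^ theta^-1 = r.
  by rewrite -powRrM divff ?gt_eqF// powRr1// ltW.
have := @has_cover_change_exponent R n theta E t s (r `^ c) 1 (r `^ theta) (powR_ge0 _ _).
rewrite rK => /(_ (fun delta => hc r delta r0 r1) cov).
rewrite mulr1 => cov'; apply/ereal_infP => _ [mu muE <-].
rewrite powRB_gt0//.
by apply: (energy_ge_of_cover r0 theta_gt0 s0 _ cov') => //; exact: powR_gt0.
Qed.

Let lim_le_below t s : A t -> t <= s -> 0 <= s -> s <= n%:R ->
  (lim (ratio s) <= (s - theta * (s - t))%:E)%E.
Proof.
by move=> [t0 At] ts s0 sn; apply: lim_ratio_le_of_cover (At _ ltr01) => //; exact: pow_up.
Qed.

Let lim_le_above t s : A t -> s <= t -> 0 <= s -> s <= n%:R ->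
  (lim (ratio s) <= t%:E)%E.
Proof.
move=> [t0 At] st s0 sn; rewrite (_ : t = s - (s - t)); last by ring.
by apply: lim_ratio_le_of_cover (At _ ltr01) => //; exact: pow_down.
Qed.

(** Energies at least [r^a] give covers with sum [C r^(s - a - 2 n / K)] at exponent [s]; passing to
    exponent [t] multiplies by [r^b]. *)
Let mem_of_ratio_le s t a b : 0 <= s -> s <= n%:R -> 0 <= t -> 0 < s - a + b ->
  (forall r delta, 0 < r -> r < 1 -> r <= delta -> delta <= r `^ theta ->
     delta `^ t <= r `^ b * delta `^ s) ->
  Q (fun r => (ratio s r <= a%:E)%E) -> A t.
Proof.
move=> s0 sn t0 sab hb Qs; split=> // eps eps0.
apply: (Q_powR (has_cover theta E t eps)).1; apply: Q_mono Qs.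
have [d d1 Ed] := exists_diam; have d0 : 0 < d by exact: lt_le_trans d1.
pose e := s - a + b.
(* Enough scales for the loss [2 n / K] to be at most [e / 2]; the remaining [r^(e / 2)] beats
   [C / eps]. *)
pose K := (Num.truncn (4 * n%:R / e)).+1.
have K0 : 0 < K%:R :> R by rewrite ltr0n.
have Ke : 2 * n%:R / K%:R <= e / 2.
  rewrite ler_pdivrMr// [e / 2 * _]mulrC -ler_pdivrMr ?divr_gt0//.
  rewrite (_ : 2 * n%:R / (e / 2) = 4 * n%:R / e); last by field; rewrite gt_eqF.
  by apply/ltW; exact: truncnS_gt.
pose C : R := 2 * K.+1%:R ^+ 2 * (2 * Num.sqrt n%:R + 2) ^+ n.
have C0 : 0 < C.
  have : 0 < 2 * Num.sqrt n%:R + 2 :> R by rewrite ltr_wpDl// mulr_ge0 ?sqrtr_ge0.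
  by move=> ?; rewrite !mulr_gt0 ?exprn_gt0.
have [r0 r0_gt0 hr0] := powR_eventually_le C0 (divr_gt0 sab (ltr0n _ 2)) eps0.
exists (Num.min r0 (Num.min 1 d^-1)); first by rewrite !lt_min r0_gt0 ltr01 invr_gt0.
move=> r rgt0; rewrite !lt_min => /and3P[rr0 r1 rd].
rewrite (log_capacity_ratio_le theta_le1 E0 d1 Ed)// => ga.
have cov : has_cover theta E s (C * r `^ (s - 2 * n%:R / K%:R) / r `^ a) (r `^ theta).
  apply: has_cover_of_discrete_energy => //; last 2 first.
  - exact: powR_gt0.
  - by move=> p Ep; rewrite -lee_fin; apply: le_trans (min_energy_le_discrete _ _ _ Ep).
  move=> x y Ex Ey; apply: le_lt_trans (Ed _ _ Ex Ey) _.
  by rewrite -[d]invrK ltf_pV2 ?posrE ?invr_gt0.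
have rK : (r `^ theta) `^ theta^-1 = r.
  by rewrite -powRrM divff ?gt_eqF// powRr1// ltW.
have := @has_cover_change_exponent R n theta E s t (r `^ b)
  (C * r `^ (s - 2 * n%:R / K%:R) / r `^ a) (r `^ theta) (powR_ge0 _ _).
rewrite rK => /(_ (fun delta => hb r delta rgt0 r1) cov).
apply: has_coverW; apply: le_trans (hr0 _ rgt0 rr0).
rewrite (_ : r `^ b * _ = C * r `^ (s - 2 * n%:R / K%:R - a + b)); last first.
  by rewrite (powRD_gt0 _ b rgt0) (powRB_gt0 (s - _) a rgt0); ring.
rewrite ler_pM2l// ger_powR ?rgt0 ?(ltW r1)//.
by move: Ke; rewrite /e; lra.
Qed.

(** The crude bound [(r / d)^n] puts the ratio at [s = n] barely above [n]. Raising the exponent to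
    [t] gains [r^(theta (t - n))], half of which absorbs [d^n]. *)
Let A_gt t : n%:R < t -> A t.
Proof.
move=> nt; have t0 : 0 <= t by apply: le_trans (ltW nt).
have tn0 : 0 < theta * (t - n%:R) by rewrite mulr_gt0// subr_gt0.
apply: (@mem_of_ratio_le n%:R t (n%:R + theta * (t - n%:R) / 2) (theta * (t - n%:R))) => //.
- by lra.
- by apply: pow_up; exact: ltW.
apply: Q_mono Q_True.
have [d d1 Ed] := exists_diam; have d0 : 0 < d by exact: lt_le_trans d1.
have [r0 r0_gt0 hr0] := powR_eventually_le (exprn_gt0 n d0) (divr_gt0 tn0 (ltr0n _ 2)) ltr01.
exists (Num.min r0 1); first by rewrite lt_min r0_gt0 ltr01.
move=> r rgt0; rewrite lt_min => /andP[rr0 r1] _.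
rewrite (log_capacity_ratio_le theta_le1 E0 d1 Ed)//.
apply: le_trans (min_energy_ge rgt0 r1 theta_le1 (lexx _) d1 Ed).
rewrite lee_fin (powRD_gt0 _ _ rgt0) powR_mulrn ?(ltW rgt0)// expr_div_n.
rewrite ler_pM2l ?exprn_gt0// -[leRHS]mul1r ler_pdivlMr ?exprn_gt0// mulrC.
exact: hr0.
Qed.

Let ratio_not_lt0 s a : a < 0 -> 0 <= s -> s <= n%:R ->
  ~ Q (fun r => (ratio s r <= a%:E)%E).
Proof.
move=> a0 s0 sn Qs; apply: Q_False; apply: Q_mono Qs; exists 1 => // r rgt0 r1.
have [d d1 Ed] := exists_diam.
rewrite (log_capacity_ratio_le theta_le1 E0 d1 Ed)//.
move=> /le_trans /(_ (min_energy_le1 theta s rgt0 E0)); rewrite lee_fin => /ln_le0.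
by rewrite ln_powR leNgt nmulr_rgt0// ln_lt0// rgt0.
Qed.

(** Covers at exponents near [inf A] bound the limit there from above, and a smaller limit would put
    some [t < inf A] in [A]. Any other fixed point, above or below, is excluded because [pow_up]
    gives a strict gain. *)
Lemma dim_eq_fixed_point : exists d : R,
  [/\ ereal_inf [set s%:E | s in [set s : R | 0 <= s /\
         forall eps, 0 < eps -> Q (has_cover theta E s eps)]] = d%:E,
      0 <= d, d <= n%:R, lim (ratio d) = d%:E &
      forall s, 0 <= s -> s <= n%:R -> lim (ratio s) = s%:E -> s = d].
Proof.
rewrite -/A.
have lbA : lbound A 0 by move=> s [].
have neA : A !=set0 by exists (n%:R + 1); apply: A_gt; rewrite ltrDl.
have infA : has_inf A by split => //; exists 0.
have inf_le t : A t -> inf A <= t by move=> At; apply: inf_lbound => //; exists 0.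
have A_gt_inf t : inf A < t -> A t.
  by move=> /(inf_lt neA)[s As /ltW]; exact: A_up.
exists (inf A).
have d0 : 0 <= inf A by exact: lb_le_inf.
have dn : inf A <= n%:R.
  by apply/ler_addgt0Pr => e e0; apply: inf_le; apply: A_gt; rewrite ltrDl.
split => //.
- by apply: ereal_inf_EFin => //; exists 0.
- apply/eqP; rewrite eq_le; apply/andP; split.
    apply/lee_addgt0Pr => e e0; rewrite -EFinD.
    by apply: lim_le_above => //; [apply: A_gt_inf; rewrite ltrDl|rewrite lerDl ltW].
  rewrite leNgt; apply/negP => /lim_lt[a ad Qa].
  (* At dimension 0 there is no smaller admissible exponent, so the contradiction comes from
     capacities being at least 1. *)
  have [dz|dpos] := eqVneq (inf A) 0.
    by apply: (@ratio_not_lt0 (inf A) a) => //; rewrite -dz.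
  have {}dpos : 0 < inf A by rewrite lt_neqAle eq_sym dpos.
  pose t := Num.max 0 ((inf A + a) / 2).
  have t0 : 0 <= t by rewrite le_max lexx.
  have td : t < inf A by rewrite gt_max dpos/=; lra.
  have at_ : a < t by rewrite lt_max; apply/orP; right; lra.
  suff /inf_le : A t by rewrite leNgt td.
  apply: (@mem_of_ratio_le (inf A) t a (t - inf A)) => //; first by lra.
  by apply: pow_down; exact: ltW.
- move=> s s0 sn lims; apply/eqP; rewrite eq_le !leNgt; apply/andP; split; apply/negP.
    move=> ds.
    have As : A ((s + inf A) / 2) by apply: A_gt_inf; lra.
    have := lim_le_below As _ s0 sn; rewrite lims lee_fin.
    have : 0 < theta * (s - (s + inf A) / 2) by rewrite mulr_gt0//; lra.
    by move=> + H; have := H ltac:(lra); lra.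
  (* Moving from [s] to [t] gains [theta * (t - s)]; since the limit is [s], the ratio stays below
     [s] plus this gain along [Q], which forces [A t]. *)
  move=> sd; pose t := (s + inf A) / 2.
  have st : s < t by rewrite /t; lra.
  have ts0 : 0 < theta * (t - s) by rewrite mulr_gt0// subr_gt0.
  have : (lim (ratio s) < (s + theta * (t - s))%:E)%E by rewrite lims lte_fin ltrDl.
  move=> /lim_lt[a ha Qa].
  suff /inf_le : A t by rewrite /t; lra.
  apply: (@mem_of_ratio_le s t a (theta * (t - s))) => //.
  - by rewrite /t; lra.
  - by lra.
  by apply: pow_up; exact: ltW.
Qed.

Lemma dim_eq_profile :
  ereal_inf [set s%:E | s in [set s : R | 0 <= s /\
    forall eps, 0 < eps -> Q (has_cover theta E s eps)]] =
  (xget (-1) [set s | unique (fun s : R =>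
    [/\ 0 <= s, s <= n%:R & lim (ratio s) = s%:E]) s])%:E.
Proof.
have [d [-> d0 dn limd d_uniq]] := dim_eq_fixed_point.
rewrite (@xget_unique _ _ _ d)//.
  by split=> // s [s0 sn lims]; rewrite (d_uniq s).
by move=> s [[s0 sn lims] _]; exact: d_uniq.
Qed.

End profile.

(** * Lower and upper limits at 0 from the right *)

Section one_sided_limits.
Context (R : realType).
Implicit Types (f : R -> \bar R) (a : R) (V : set R).

Lemma nbhs_right0P V : (0^'+ : set_system R) V <->
  exists2 e : R, 0 < e & forall r, 0 < r -> r <= e -> V r.
Proof.
split=> [[e /= e0 Ve]|[e e0 Ve]].
  exists (e / 2) => [|r r0 re]; first exact: divr_gt0.
  have re' : `|0 - r| < e by rewrite sub0r normrN gtr0_norm//; lra.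
  exact: Ve.
exists e => //= r re r0; apply: Ve => //.
have {}re : `|0 - r| < e by [].
by move: re; rewrite sub0r normrN gtr0_norm// => /ltW.
Qed.

Lemma lte_EFin_between (x : \bar R) a : (x < a%:E)%E ->
  exists2 b, b < a & (x < b%:E)%E.
Proof.
case: x => [l| |]//.
  by rewrite lte_fin => la; exists ((l + a) / 2); rewrite ?lte_fin; lra.
by move=> _; exists (a - 1); rewrite ?ltNye//; lra.
Qed.

Lemma limf_einf_lt f a : (limf_einf f 0^'+ < a%:E)%E -> exists2 b, b < a &
  forall r0, 0 < r0 -> exists r, [/\ 0 < r, r <= r0 & (f r <= b%:E)%E].
Proof.
move=> /lte_EFin_between[b ba fb]; exists b => // r0 r00.
apply: contrapT => nf; move: fb; rewrite ltNge => /negP; apply.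
rewrite limf_einfE; apply: (@le_trans _ _ (ereal_inf (f @` [set r | 0 < r <= r0]))).
  apply/ereal_infP => _ [r /= /andP[rgt0 rr0] <-]; rewrite leNgt; apply/negP => /ltW fr.
  by apply: nf; exists r.
apply: ereal_sup_ubound; exists [set r | 0 < r <= r0] => //.
by apply/nbhs_right0P; exists r0 => // r rgt0 rr0; apply/andP.
Qed.

Lemma limf_einf_le f a :
  (forall r0, 0 < r0 -> exists r, [/\ 0 < r, r <= r0 & (f r <= a%:E)%E]) ->
  (limf_einf f 0^'+ <= a%:E)%E.
Proof.
move=> fa; rewrite limf_einfE; apply/ereal_supP => _ [V /nbhs_right0P[e e0 Ve] <-].
have [r [r0 re fr]] := fa _ e0; apply: le_trans fr.
by apply: ereal_inf_lbound; exists r => //; exact: Ve.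
Qed.

Lemma limf_esup_lt f a : (limf_esup f 0^'+ < a%:E)%E -> exists2 b, b < a &
  exists2 r0, 0 < r0 & forall r, 0 < r -> r <= r0 -> (f r <= b%:E)%E.
Proof.
move=> /lte_EFin_between[b ba]; rewrite limf_esupE => /ereal_inf_ltP[_ [V V0 <-] fb].
exists b => //; have [e e0 Ve] := (nbhs_right0P V).1 V0; exists e => // r r0 re.
apply: le_trans (ltW fb); apply: ereal_sup_ubound; exists r => //; exact: Ve.
Qed.

Lemma limf_esup_le f a :
  (exists2 r0, 0 < r0 & forall r, 0 < r -> r <= r0 -> (f r <= a%:E)%E) ->
  (limf_esup f 0^'+ <= a%:E)%E.
Proof.
move=> [e e0 fe]; rewrite limf_esupE.
apply: (@le_trans _ _ (ereal_sup (f @` [set r | 0 < r <= e]))).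
  apply: ereal_inf_lbound; exists [set r | 0 < r <= e] => //.
  by apply/nbhs_right0P; exists e => // r r0 re; apply/andP.
by apply/ereal_supP => _ [r /= /andP[r0 re] <-]; exact: fe.
Qed.

End one_sided_limits.

(** * The lower and upper cases *)

Theorem theorem4p1 (R : realType) (n : nat) (E : set 'rV[R]_n) (theta : R)
    (hn : (0 < n)%N) (hE0 : E !=set0) (hEb : bounded_set E)
    (htheta0 : 0 < theta) (htheta1 : theta <= 1) :
  lower_intermediate_dim theta E = (lower_profile n theta E)%:E /\
  upper_intermediate_dim theta E = (upper_profile n theta E)%:E.
Proof.
have rootK (r : R) : 0 < r -> (r `^ theta^-1) `^ theta = r.
  by move=> r0; rewrite -powRrM mulVf ?gt_eqF// powRr1// ltW.
have le_root (r r0 : R) : 0 < r -> 0 < r0 -> r <= r0 `^ theta^-1 -> r `^ theta <= r0.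
  move=> rgt0 r00 rr0; rewrite -[leRHS]rootK//.
  by rewrite ge0_ler_powR ?nnegrE ?powR_ge0 ?(ltW rgt0)// ltW.
split.
  pose Q (P : R -> Prop) := forall r0, 0 < r0 -> exists r, [/\ 0 < r, r <= r0 & P r].
  have := @dim_eq_profile R n theta E hn hE0 hEb htheta0 htheta1 Q
    (fun f => limf_einf f 0^'+).
  rewrite /lower_profile /is_lower_profile => <-.
  - rewrite /lower_intermediate_dim; congr ereal_inf; congr image.
    apply/seteqP; split=> s [s0 As]; split=> //.
      by move=> eps eps0 r0 r00; exact: As.
    by move=> eps r0 eps0 r00; exact: As.
  - move=> P P' [r1 r1_gt0 PP'] QP r0 r0_gt0.
    (* Halving [r1] turns the non-strict bound of [Q] into the required [r < r1]. *)
    have [|r [rgt0 rle Pr]] := QP (Num.min r0 (r1 / 2)).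
      by rewrite lt_min r0_gt0 divr_gt0.
    move: rle; rewrite le_min => /andP[rr0 rr1]; exists r; split=> //.
    by apply: PP' => //; lra.
  (* The map sending [r] to [r^theta] is an increasing bijection of the positive reals that
     preserves smallness, with inverse power [theta^-1]. *)
  - move=> P; split=> QP r0 r0_gt0.
      have [|r [rgt0 rr0 Pr]] := QP (r0 `^ theta^-1); first exact: powR_gt0.
      by exists (r `^ theta); split; [exact: powR_gt0|exact: le_root|].
    have [|r [rgt0 rr0 Pr]] := QP (r0 `^ theta); first exact: powR_gt0.
    exists (r `^ theta^-1); split; [exact: powR_gt0| |by rewrite rootK].
    rewrite -[leRHS](powRr1 (ltW r0_gt0)) -(divff (lt0r_neq0 htheta0)) powRrM.
    by rewrite ge0_ler_powR ?invr_ge0 ?nnegrE ?powR_ge0// ltW.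
  - by move=> r0 r00; exists r0.
  - by move=> /(_ _ ltr01)[? []].
  - exact: limf_einf_lt.
  - exact: limf_einf_le.
pose Q (P : R -> Prop) := exists2 r0, 0 < r0 & forall r, 0 < r -> r <= r0 -> P r.
have := @dim_eq_profile R n theta E hn hE0 hEb htheta0 htheta1 Q
  (fun f => limf_esup f 0^'+).
rewrite /upper_profile /is_upper_profile => <-.
- rewrite /upper_intermediate_dim; congr ereal_inf; congr image.
  apply/seteqP; split=> s [s0 As]; split=> // eps eps0; have [] := As _ eps0.
    by move=> r0 []; exists r0.
  by move=> r0 r00 H; exists r0.
- move=> P P' [r1 r1_gt0 PP'] [r0 r0_gt0 QP].
  exists (Num.min r0 (r1 / 2)); first by rewrite lt_min r0_gt0 divr_gt0.
  move=> r rgt0; rewrite le_min => /andP[rr0 rr1]; apply: PP' => //; first by lra.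
  exact: QP.
- move=> P; split=> -[r0 r0_gt0 QP].
    exists (r0 `^ theta) => [|r rgt0 rr0]; first exact: powR_gt0.
    rewrite -(rootK _ rgt0); apply: QP; first exact: powR_gt0.
    rewrite -[leRHS](powRr1 (ltW r0_gt0)) -(divff (lt0r_neq0 htheta0)) powRrM.
    by rewrite ge0_ler_powR ?invr_ge0 ?nnegrE ?powR_ge0// ltW.
  exists (r0 `^ theta^-1) => [|r rgt0 rr0]; first exact: powR_gt0.
  by apply: QP; [exact: powR_gt0|exact: le_root].
- by exists 1.
- by move=> [r0 r00 /(_ r0 r00 (lexx _))].
- exact: limf_esup_lt.
- exact: limf_esup_le.
Qed.
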